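(* Let $\{a_n\}_{n\geq 1}$ be a decreasing sequence of positive real numbers with $a_n\to 0$. Let $\mathbb{S}^1=\mathbb{R}/\mathbb{Z}$ with its usual distance $\operatorname{dist}_S$, let $M=\mathbb{S}^1\times(\{a_n : n\geq 1\}\cup\{0\})$ with the distance $\operatorname{dist}((x_1,y_1),(x_2,y_2))=\max\{\operatorname{dist}_S(x_1,x_2),|y_2-y_1|\}$, and let $f\colon M\to M$ be the homeomorphism $f(x,y)=(x+y,y)$ (first coordinate taken modulo $1$). Then $f$ is not equicontinuous.
   Context: The usual distance on $\mathbb{R}/\mathbb{Z}$ is $\operatorname{dist}_S(x,y)=\min_{k\in\mathbb{Z}}|x-y+k|$. A homeomorphism $f\colon X\to X$ of a compact metric space $(X,\operatorname{dist})$ is equicontinuous if for all $\varepsilon>0$ there is $\delta>0$ such that if $x,y\in X$ and $\operatorname{dist}(x,y)<\delta$ then $\operatorname{dist}(f^n(x),f^n(y))<\varepsilon$ for all $n\in\mathbb{Z}$. *)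

(* Defs.v *)
From HB Require Import structures.
From mathcomp Require Import all_boot all_order all_algebra.
From mathcomp Require Import ring_quotient archimedean.
From mathcomp Require Import all_classical all_reals all_analysis.
From mathcomp Require Import lra zify.

Set Implicit Arguments.
Unset Strict Implicit.
Unset Printing Implicit Defensive.

Import Order.TTheory GRing.Theory Num.Theory.
Import numFieldNormedType.Exports.

Local Open Scope classical_set_scope.
Local Open Scope quotient_scope.
Local Open Scope ring_scope.

Record homeomorphism (X : topologicalType) := Homeomorphism {
  homeo_fun :> X -> X;
  homeo_inv : X -> X;
  homeo_funK : cancel homeo_fun homeo_inv;
  homeo_invK : cancel homeo_inv homeo_fun;
  homeo_fun_continuous : continuous homeo_fun;
  homeo_inv_continuous : continuous homeo_inv }.

Definition iterz (X : topologicalType) (f : homeomorphism X) (n : int) : X -> X :=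
  match n with
  | Posz m => iter m f
  | Negz m => iter m.+1 (homeo_inv f)
  end.

(* Uniform over the space: the library's [equicontinuous] is the pointwise
   notion, which agrees with this one on compact spaces. *)
Definition equicontinuous_homeo (R : numDomainType) (X : metricType R)
    (f : homeomorphism X) : Prop :=
  forall eps : R, 0 < eps -> exists2 delta : R, 0 < delta &
    forall x y : X, mdist x y < delta ->
      forall n : int, mdist (iterz f n x) (iterz f n y) < eps.

(* R/Z, the quotient of the additive group of R by the subgroup of its integers;
   [Num.int_num_subdef] is the predicate underlying [_ \is a Num.int]. *)
Definition circle (R : realType) : Type :=
  Quotient.quot (GRing.ZmodClosed.clone R (@Num.int_num_subdef R) _).

HB.instance Definition _ (R : realType) := GRing.Zmodule.on (circle R).
HB.instance Definition _ (R : realType) := Quotient.on (circle R).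

(* The infimum is a minimum and does not depend on the representatives:
   see [circle_distP]. *)
Definition circle_dist (R : realType) (x y : circle R) : R :=
  inf [set `|repr x - repr y + k%:~R| | k in [set: int]].

Section circle_metric.
Variable R : realType.
Implicit Types (r s : R) (x y z : circle R).

Lemma circle_eqP r s :
  \pi_(circle R) r = \pi_(circle R) s <-> exists k : int, r = s + k%:~R.
Proof.
split=> [/eqP|[k ->]]; last first.
  by apply/eqP; rewrite -Quotient.idealrBE addrC addKr; exact: (intr_int R k).
rewrite -Quotient.idealrBE => /intrP[k rsk].
by exists k; rewrite -rsk addrC subrK.
Qed.

Lemma circle_piD r s :
  \pi_(circle R) (r + s) = \pi_(circle R) r + \pi_(circle R) s.
Proof. by rewrite [LHS]Quotient.pi_add. Qed.

Lemma circle_piN r : \pi_(circle R) (- r) = - \pi_(circle R) r.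
Proof. by rewrite [LHS]Quotient.pi_opp. Qed.

Lemma exists_nearest r :
  exists k : int, forall j : int, `|r + k%:~R| <= `|r + j%:~R|.
Proof.
have /andP[zl zr] := floor_itv r; set n := Num.floor r in zl zr.
have H (j : int) : (n%:~R + j%:~R >= 0 :> R) \/ (n%:~R + j%:~R <= -1 :> R).
  have [h|h] := leP 0 (n + j); [left|right].
    by rewrite -intrD ler0z.
  by rewrite -intrD -[- 1](@intrN R 1) ler_int; lia.
rewrite intrD in zr.
have [h|h] := leP (r - n%:~R) (2^-1).
  exists (- n) => j; rewrite intrN ger0_norm ?subr_ge0//.
  by have [h1|h1] := H j; have [h2|h2] := ler0P (r + j%:~R); lra.
exists (- n - 1) => j; rewrite intrB intrN ler0_norm; last lra.
by have [h1|h1] := H j; have [h2|h2] := ler0P (r + j%:~R); lra.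
Qed.

Lemma circle_distP r s : exists2 k : int,
  circle_dist (\pi r) (\pi s) = `|r - s + k%:~R| &
  forall j : int, `|r - s + k%:~R| <= `|r - s + j%:~R|.
Proof.
have [i ri] := (circle_eqP _ _).1 (reprK (\pi_(circle R) r)).
have [j sj] := (circle_eqP _ _).1 (reprK (\pi_(circle R) s)).
have [k km] := exists_nearest (r - s).
exists k => //; rewrite /circle_dist ri sj.
have E (l : int) : r + i%:~R - (s + j%:~R) + l%:~R = r - s + (l + i - j)%:~R.
  by rewrite !(intrD, intrN); lra.
set A := [set _ | _ in _]; have lbA : lbound A `|r - s + k%:~R|.
  by move=> _ [l _ <-]; rewrite E.
have Ak : A `|r - s + k%:~R|.
  by exists (k + j - i) => //; rewrite E; congr (`|_ + _%:~R|); lia.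
apply/eqP; rewrite eq_le lb_le_inf ?andbT//; last by exists `|r - s + k%:~R|.
by apply: ge_inf => //; exists `|r - s + k%:~R|.
Qed.

Lemma circle_dist_le r s : circle_dist (\pi r) (\pi s) <= `|r - s|.
Proof. by have [k -> /(_ 0)] := circle_distP r s; rewrite addr0. Qed.

Let dist_xx x : circle_dist x x = 0.
Proof.
rewrite -[x]reprK; have := circle_dist_le (repr x) (repr x).
rewrite subrr normr0; have [k -> _] := circle_distP (repr x) (repr x) => h.
by apply/eqP; rewrite eq_le h normr_ge0.
Qed.

Let dist_positivity x y : circle_dist x y = 0 -> x = y.
Proof.
rewrite -[x]reprK -[y]reprK.
have [k -> _] := circle_distP (repr x) (repr y) => /normr0_eq0 h.
by apply/circle_eqP; exists (- k); rewrite intrN; lra.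
Qed.

Let dist_sym x y : circle_dist x y = circle_dist y x.
Proof.
suff H (a b : circle R) : circle_dist a b <= circle_dist b a.
  by apply/eqP; rewrite eq_le !H.
rewrite -[a]reprK -[b]reprK.
have [k -> km] := circle_distP (repr a) (repr b).
have [l -> lm] := circle_distP (repr b) (repr a).
rewrite (le_trans (km (- l)))// intrN -normrN.
by rewrite (_ : - (_ - _ - _) = repr b - repr a + l%:~R)//; lra.
Qed.

Let dist_triangle y x z : circle_dist x z <= circle_dist x y + circle_dist y z.
Proof.
rewrite -[x]reprK -[y]reprK -[z]reprK.
have [k -> _] := circle_distP (repr x) (repr y).
have [l -> _] := circle_distP (repr y) (repr z).
have [m -> mm] := circle_distP (repr x) (repr z).
rewrite (le_trans (mm (k + l)))// (le_trans _ (ler_normD _ _))//.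
by rewrite intrD le_eqVlt; apply/orP; left; apply/eqP; congr `|_|; lra.
Qed.

HB.instance Definition _ := @isMetric.Build R (circle R) (@circle_dist R)
  dist_xx dist_positivity dist_sym dist_triangle.

Lemma circle_distD x y x' y' :
  mdist (x + x') (y + y') <= mdist x y + mdist x' y'.
Proof.
rewrite -[x]reprK -[y]reprK -[x']reprK -[y']reprK -!circle_piD.
rewrite /mdist/=.
have [k -> _] := circle_distP (repr x) (repr y).
have [l -> _] := circle_distP (repr x') (repr y').
have [m -> mm] := circle_distP (repr x + repr x') (repr y + repr y').
rewrite (le_trans (mm (k + l)))// (le_trans _ (ler_normD _ _))//.
by rewrite intrD le_eqVlt; apply/orP; left; apply/eqP; congr `|_|; lra.
Qed.

End circle_metric.

(* {a n : n >= 1} together with 0; the value [a 0] is not used. *)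
Definition levels (R : realType) (a : nat -> R) : set R :=
  [set a n | n in [set n | (1 <= n)%N]] `|` [set 0].

Definition cylinder (R : realType) (a : nat -> R) : Type :=
  {p : circle R * R | p.2 \in levels a}.

HB.instance Definition _ (R : realType) (a : nat -> R) :=
  Choice.on (cylinder a).
HB.instance Definition _ (R : realType) (a : nat -> R) :=
  SubType.on (cylinder a).

Definition cylinder_dist (R : realType) (a : nat -> R) (p q : cylinder a) : R :=
  Num.max (mdist (val p).1 (val q).1) `|(val q).2 - (val p).2|.

Section cylinder_metric.
Variables (R : realType) (a : nat -> R).
Implicit Types p q : cylinder a.

Let dist_xx p : cylinder_dist p p = 0.
Proof. by rewrite /cylinder_dist mdistxx subrr normr0 maxxx. Qed.

Let dist_positivity p q : cylinder_dist p q = 0 -> p = q.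
Proof.
rewrite /cylinder_dist => /eqP; rewrite eq_le ge_max => /andP[/andP[h1 h2] _].
apply/val_inj; rewrite [val p]surjective_pairing [val q]surjective_pairing.
congr (_, _).
  by apply: mdist_positivity; apply/eqP; rewrite eq_le h1 mdist_ge0.
by apply/eqP; rewrite eq_sym -subr_eq0 -normr_le0.
Qed.

Let dist_sym p q : cylinder_dist p q = cylinder_dist q p.
Proof. by rewrite /cylinder_dist metric_sym distrC. Qed.

Let dist_triangle q p r :
  cylinder_dist p r <= cylinder_dist p q + cylinder_dist q r.
Proof.
rewrite /cylinder_dist ge_max; apply/andP; split.
  by rewrite (le_trans (metric_triangle _ (val q).1 _))// lerD// le_max lexx.
rewrite [leRHS]addrC (le_trans (ler_distD (val q).2 _ _))// lerD//.
  by rewrite le_max lexx orbT.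
by rewrite le_max lexx orbT.
Qed.

HB.instance Definition _ := @isMetric.Build R (cylinder a) (@cylinder_dist R a)
  dist_xx dist_positivity dist_sym dist_triangle.

End cylinder_metric.

Section twist.
Variables (R : realType) (a : nat -> R).

Definition twist_fun (p : cylinder a) : cylinder a :=
  exist _ ((val p).1 + \pi_(circle R) (val p).2, (val p).2) (valP p).

Definition twist_inv (p : cylinder a) : cylinder a :=
  exist _ ((val p).1 - \pi_(circle R) (val p).2, (val p).2) (valP p).

Let twist_funK : cancel twist_fun twist_inv.
Proof. by move=> p; apply/val_inj => /=; rewrite addrK -surjective_pairing. Qed.

Let twist_invK : cancel twist_inv twist_fun.
Proof. by move=> p; apply/val_inj => /=; rewrite subrK -surjective_pairing. Qed.

Let twist_dist p q e : cylinder_dist p q < e / 2 ->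
  cylinder_dist (twist_fun p) (twist_fun q) < e.
Proof.
rewrite /cylinder_dist !gt_max /= => /andP[h1 h2].
have /= h0 := circle_dist_le (val p).2 (val q).2; rewrite distrC in h0.
rewrite (le_lt_trans (circle_distD _ _ _ _)) /=; last first.
  by rewrite [e]splitr ltrD// (le_lt_trans h0).
have := normr_ge0 ((val q).2 - (val p).2); lra.
Qed.

Let twist_inv_dist p q e : cylinder_dist p q < e / 2 ->
  cylinder_dist (twist_inv p) (twist_inv q) < e.
Proof.
rewrite /cylinder_dist !gt_max /= => /andP[h1 h2].
have /= h0 := circle_dist_le (- (val p).2) (- (val q).2).
rewrite opprK addrC in h0; rewrite -!circle_piN.
rewrite (le_lt_trans (circle_distD _ _ _ _)) /=; last first.
  by rewrite [e]splitr ltrD// (le_lt_trans h0).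
have := normr_ge0 ((val q).2 - (val p).2); lra.
Qed.

Let twist_fun_continuous : continuous twist_fun.
Proof.
move=> p U /nbhs_ballP[e /= e0 eU]; apply/nbhs_ballP.
exists (e / 2) => [|q]; first by rewrite /= divr_gt0.
rewrite ballEmdist => /twist_dist pqe; apply: eU.
by rewrite ballEmdist; exact: pqe.
Qed.

Let twist_inv_continuous : continuous twist_inv.
Proof.
move=> p U /nbhs_ballP[e /= e0 eU]; apply/nbhs_ballP.
exists (e / 2) => [|q]; first by rewrite /= divr_gt0.
rewrite ballEmdist => /twist_inv_dist pqe; apply: eU.
by rewrite ballEmdist; exact: pqe.
Qed.

Definition twist : homeomorphism (cylinder a) :=
  Homeomorphism twist_funK twist_invK twist_fun_continuous twist_inv_continuous.

End twist.

Lemma levels_compact (R : realType) (a : nat -> R) :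
  a n @[n --> \oo] --> 0 -> compact (levels a).
Proof.
move=> a0; rewrite compact_ultra => F UF FA.
have [F0|] := pselect (F --> (0 : R)).
  by exists 0; split => //; right.
move/cvg_ballP/existsNP => [e /not_implyP[e0 nFe]].
have [//|FC] := in_ultra_setVsetC (ball (0 : R) e) UF.
have /cvgrPdist_lt/(_ e e0)[N _ aN] := a0.
pose B := [set a n | n in [set n | (1 <= n < N)%N]].
have finB : finite_set B.
  by apply/finite_image/(sub_finite_set _ (finite_II N)) => n /= /andP[].
have FB : F B.
  apply: filterS (filterI FA FC) => y [[[n n1 <-]|->] /= nb].
    exists n => //=; rewrite n1/= ltnNge; apply/negP => Nn.
    by apply: nb; rewrite -ball_normE /=; exact: aN.
  by exfalso; apply: nb; exact: ballxx.
have := finite_compact finB; rewrite compact_ultra => /(_ F UF FB)[y [By Fy]].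
by exists y; split=> //; case: By => n /= /andP[n1 _] <-; left; exists n.
Qed.

Lemma cylinder_compact (R : realType) (a : nat -> R) :
  a n @[n --> \oo] --> 0 -> compact [set: cylinder a].
Proof.
move=> a0.
have z0 : (0 : R) \in levels a by apply/mem_set; right.
pose g (u : R * R) : cylinder a :=
  exist (fun p => p.2 \in levels a) (\pi_(circle R) u.1, val (insubd (exist _ 0 z0 : {s | s \in levels a}) u.2))
  (valP (insubd (exist _ 0 z0 : {s | s \in levels a}) u.2)).
pose K : set (R * R) := `[0%R, 1%R]%classic `*` levels a.
have cK : compact K.
  by apply: compact_setX; [exact: segment_compact|exact: levels_compact].
have gv u : u.2 \in levels a -> (val (g u)).2 = u.2.
  by move=> ul; rewrite /g /= insubdK.
have cg : {within K, continuous g}.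
  apply/subspace_continuousP => u [_ ul]; apply/cvg_ballP => e e0.
  rewrite near_withinE; near=> v => -[_ vl]; rewrite ballEmdist /=.
  have [h1 h2] : ball u e v by near: v; exact: nbhsx_ballx.
  rewrite -!ball_normE/= in h1 h2.
  rewrite [mdist _ _]/(cylinder_dist _ _) /cylinder_dist !gv ?inE//.
  by rewrite gt_max distrC h2 andbT (le_lt_trans (circle_dist_le _ _)).
have := continuous_compact cg cK; congr compact.
apply/seteqP; split=> // p _; case: p => -[x s] /= sl.
rewrite -[x]reprK; exists (repr x - (Num.floor (repr x))%:~R, s).
  split; last by rewrite /= -inE.
  by have := floor_itv (repr x); rewrite intrD /= in_itv/= => ?; lra.
apply/val_inj; rewrite /= insubdK//; congr (_, _).
by apply/circle_eqP; exists (- Num.floor (repr x)); rewrite intrN.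
Unshelve. all: by end_near. Qed.

(* Main.v *)
Require Import Defs.
From HB Require Import structures.
From mathcomp Require Import all_boot all_order all_algebra.
From mathcomp Require Import all_classical all_reals all_analysis.
From mathcomp Require Import lra.

Set Implicit Arguments.
Unset Strict Implicit.
Unset Printing Implicit Defensive.

Import Order.TTheory GRing.Theory Num.Theory.
Import numFieldNormedType.Exports.

Local Open Scope classical_set_scope.
Local Open Scope ring_scope.

(** Points of the circle [y = 0] are fixed, while [f] rotates the circle
    [y = t] by the angle [t].  The points [(0, 0)] and [(0, t)] are at distance
    at most [t], but for [0 < t <= 1/2] some multiple of [t] falls in
    [[1/4, 3/4]], so that some iterate separates them by at least [1/4]. *)

Lemma iter_twist (R : realType) (a : nat -> R) (m : nat) (p : cylinder a) :
  val (iter m (twist a) p) =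
  ((val p).1 + \pi_(circle R)%qT ((val p).2 *+ m), (val p).2).
Proof.
elim: m => [|m IHm].
  rewrite [LHS]surjective_pairing mulr0n; congr (_, _).
  by rewrite -[X in X + _]reprK -circle_piD addr0 reprK.
by rewrite iterS /= IHm /= mulrSr circle_piD addrA.
Qed.

(** An integer shift [k >= 0] leaves [r - s + k] at least [e], and a shift [k <= -1] brings it down
    to at most [- e]. *)
Lemma circle_dist_pi_ge (R : realType) (e r s : R) :
  e <= r - s <= 1 - e -> e <= mdist (\pi_(circle R)%qT r) (\pi_(circle R)%qT s).
Proof.
move=> /andP[el er]; rewrite /mdist /=.
have [k -> _] := circle_distP r s.
have [k0|k0] := leP 0 k.
  have : 0 <= k%:~R :> R by rewrite ler0z.
  by have := ler_norm (r - s + k%:~R); lra.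
have : (k + 1)%:~R <= 0 :> R by rewrite lerz0 lezD1.
by have := ler_norm (- (r - s + k%:~R)); rewrite normrN intrD; lra.
Qed.

(** Take the first multiple of [t] beyond [c]: the preceding one is at most [c], so the overshoot is
    at most [t]. *)
Lemma exists_mulrn_between (R : archiRealFieldType) (t c : R) :
  0 < t -> 0 <= c -> exists m : nat, c < t *+ m <= c + t.
Proof.
move=> t0 c0; exists (Num.truncn (c / t)).+1.
have /truncn_itv/andP[lo hi] : 0 <= c / t by rewrite divr_ge0// ltW.
rewrite -mulr_natl -ltr_pdivrMr// hi/= -natr1 mulrDl mul1r lerD2r.
by rewrite -ler_pdivlMr.
Qed.

Theorem mainTheorem4 (R : realType) (a : nat -> R)
  (a_pos : forall n : nat, (1 <= n)%N -> 0 < a n)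
  (a_decr : forall m n : nat, (1 <= m)%N -> (m <= n)%N -> a n <= a m)
  (a_lim : a n @[n --> \oo] --> (0 : R)) :
  ~ equicontinuous_homeo (twist a).
Proof.
have e0 : 0 < 4^-1 :> R by rewrite invr_gt0 ltr0n.
move=> /(_ _ e0)[d d0 equi].
(* The bound [d] makes the two starting points close; the bound [2^-1] ensures
   [4^-1 + t <= 1 - 4^-1]. *)
have m0 : 0 < Num.min d 2^-1 by rewrite lt_min d0 invr_gt0 ltr0n.
have /cvgrPdist_lt/(_ _ m0)[N _ aN] := a_lim.
(* The successor keeps the index at least 1 even when [N = 0], as [a_pos] and [levels] require. *)
pose t := a N.+1.
have t0 : 0 < t by exact: a_pos.
have := aN N.+1 (leqnSn N).
rewrite /= sub0r normrN -/t gtr0_norm// lt_min => /andP[td t2].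
have z_lev : (0 : R) \in levels a by apply/mem_set; right.
have t_lev : t \in levels a by apply/mem_set; left; exists N.+1.
pose x : cylinder a := exist _ (0 : circle R, t) t_lev.
pose y : cylinder a := exist _ (0 : circle R, 0) z_lev.
have xy : mdist x y < d.
  rewrite [mdist _ _]/(cylinder_dist _ _) /cylinder_dist /= mdistxx gt_max d0.
  by rewrite sub0r normrN gtr0_norm.
have [m /andP[mlo mhi]] := exists_mulrn_between t0 (ltW e0).
have := equi x y xy (Posz m).
rewrite [mdist _ _]/(cylinder_dist _ _) /cylinder_dist !iter_twist /=.
(* Only the circle coordinates matter: after [m] steps they are the classes of [t *+ m] and [0]. *)
rewrite gt_max => /andP[+ _]; apply/negP; rewrite -leNgt !add0r mul0rn.
by apply: circle_dist_pi_ge; apply/andP; split; lra.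
Qed.
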